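(* For every $\varepsilon\in(0,1/2)$ there exists a constant $c=c_\varepsilon>0$ such that for all positive integers $n,d$ with $\varepsilon n<d<(1-\varepsilon)n$, $$A^{\mathrm{per}}(n,d+1)\ge cn\cdot\frac{n!}{\mathrm{vol}^{\mathrm{per}}(n,d)}.$$ Furthermore, the number of length-$n$ permutation codes with minimum distance at least $d$ is at least $$\exp\left(cn^2\cdot\frac{n!}{\mathrm{vol}^{\mathrm{per}}(n,d)}\right).$$
   Context: $S_n$ is the symmetric group on $[n]$, with Hamming distance $\Delta(\sigma,\tau)=|\{i\in[n]:\sigma(i)\ne\tau(i)\}|$. A length-$n$ permutation code is a subset $\mathcal C\subseteq S_n$; it has minimum distance at least $m$ if any two distinct elements of $\mathcal C$ have Hamming distance at least $m$. $A^{\mathrm{per}}(n,m)$ is the largest size of a length-$n$ permutation code with minimum distance at least $m$. $\mathrm{vol}^{\mathrm{per}}(n,d)$ is the number of permutations in $S_n$ at Hamming distance at most $d$ from a fixed permutation. *)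

(* Defs.v *)
From mathcomp Require Import all_boot all_fingroup.

Set Implicit Arguments.
Unset Strict Implicit.
Unset Printing Implicit Defensive.

Definition hamming n (s t : 'S_n) : nat := #|[set i : 'I_n | s i != t i]|.

Definition min_dist_ge n (m : nat) (C : {set 'S_n}) : bool :=
  [forall s in C, forall t in C, (s != t) ==> (m <= hamming s t)].

(* The empty code is always admissible, so this is a maximum over a nonempty
   finite family. *)
Definition A_per (n m : nat) : nat :=
  \max_(C : {set 'S_n} | min_dist_ge m C) #|C|.

Definition hamming_ball n (s : 'S_n) (d : nat) : {set 'S_n} :=
  [set t | hamming s t <= d].

(* The center is immaterial: see card_hamming_ball. *)
Definition vol_per (n d : nat) : nat := #|hamming_ball (1%g : 'S_n) d|.

Definition num_codes (n m : nat) : nat :=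
  #|[set C : {set 'S_n} | min_dist_ge m C]|.

Lemma card_hamming_ball n (s : 'S_n) d : #|hamming_ball s d| = vol_per n d.
Proof.
have hammingM t : hamming s (s * t)%g = hamming 1%g t.
  rewrite /hamming -[RHS](card_preimset _ (@perm_inj _ s)).
  by apply: eq_card => i; rewrite !inE permM perm1.
have -> : hamming_ball s d = [set (s * t)%g | t in hamming_ball 1%g d].
  apply/setP => t; apply/idP/imsetP => [|[u + ->]]; last first.
    by rewrite !inE hammingM.
  rewrite inE => st_d; exists (s^-1 * t)%g; last by rewrite mulKVg.
  by rewrite inE -hammingM mulKVg.
by rewrite card_imset //; exact: mulgI.
Qed.

(* Main.v *)
Require Import Defs.
From mathcomp Require Import all_boot all_order all_algebra.
From mathcomp Require Import reals sequences exp.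
From mathcomp Require Import all_fingroup.
From mathcomp Require Import ring lra zify.
Import Order.TTheory GRing.Theory Num.Theory.
Local Open Scope ring_scope.

(** A code of minimum distance at least d + 1 is a stable set in the graph on
    S_n that joins permutations at distance at most d.  The degrees are below
    D = vol_per n d, and a greedy choice gives only n! / D.  The gain of a
    factor n comes from local sparsity: two random neighbours of a vertex are
    themselves adjacent only with probability exp(-Omega(n)).

    Local sparsity is exploited by [stable_set_of_sparse_nbrs]: if every
    neighbourhood spans at most D^2 e^(-6(L+1)) ordered edges and D is at least
    2 e^(3(L+1)), then some stable set has at least L |T| / (2 D) elements.
    Draw a stable set I with probability proportional to lam^|I|.  Given the
    part of I outside the closed neighbourhood of v, the rest of I is either v
    alone or a stable subset of the set U of those neighbours of v that are
    still allowed.  If U is small, v itself is chosen with probability at least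
    L / D; if U is large, then, U being sparse, I is expected to meet it in
    about lam |U| vertices.  Both cases give D P(v in I) + E|I meets N(v)| >= L,
    and summing over v bounds 2 D E|I| from below by L |T|.

    Local sparsity of the Hamming graph is [card_close_pairs].  Let s and t move
    at most d points each and be at distance at most d.  If they have few common
    fixed points, then the fixed points of t and the points where t agrees with
    s together prescribe n - d + r values of t, which leaves at most (d - r)!
    choices: a superexponential loss for r proportional to n.  If they have at
    least n - d - r common fixed points, then the two sets of fixed points
    nearly coincide, which costs a factor of about 'C(n, d), exponentially
    large because d / n stays away from 0 and 1.  These counts are compared
    with vol_per n d through d * vol_per n d >= 'C(n, d) * d!
    ([vol_per_ge]).

    For the number of codes of minimum distance at least d, all subsets of one
    largest such code suffice: there are 2^(A_per n d) of them.  The first part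
    for d - 1 bounds A_per n d by a multiple of n * n! / vol_per n (d - 1), and
    the second factor n appears because vol_per n d exceeds vol_per n (d - 1)
    by a factor of order n - d ([vol_per_ratio]).  The finitely many small n
    are absorbed in the constant. *)

Set Implicit Arguments.
Unset Strict Implicit.
Unset Printing Implicit Defensive.

(** * Stable sets in locally sparse graphs *)

Lemma cube_dominates (R : realType) (E L : R) :
  0 <= L -> L + 2 <= E -> L * (1 + E ^+ 2) <= E ^+ 3.
Proof. nra. Qed.

Lemma cube_ge (R : realType) (E L : R) :
  0 <= L -> L + 2 <= E -> L <= 2 * E ^+ 3.
Proof. move=> L0 LE; have -> : E ^+ 3 = E * E * E by ring. nra. Qed.

Section HardCore.
Variables (R : realType) (T : finType) (e : rel T).
Hypotheses (e_sym : symmetric e) (e_irr : irreflexive e).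

Definition nbrs (v : T) : {set T} := [set u | e v u].

Definition closed_nbrs (v : T) : {set T} := v |: nbrs v.

Definition stable (A : {set T}) : bool :=
  [forall x in A, forall y in A, ~~ e x y].

Lemma stableP (A : {set T}) :
  reflect {in A &, forall x y, ~~ e x y} (stable A).
Proof.
apply: (iffP forall_inP) => [H x y xA yA|H x xA].
  by move/forall_inP: (H x xA); apply.
by apply/forall_inP => y yA; exact: H.
Qed.

Lemma stable0 : stable set0.
Proof. by apply/stableP => x y; rewrite inE. Qed.

Lemma stableS (A B : {set T}) : A \subset B -> stable B -> stable A.
Proof.
move=> /subsetP sAB /stableP sB; apply/stableP => x y xA yA.
by apply: sB; apply: sAB.
Qed.

Lemma stableU (A B : {set T}) :
  stable (A :|: B) =
  [&& stable A, stable B & [forall x in A, forall y in B, ~~ e x y]].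
Proof.
apply/idP/and3P => [sAB|[/stableP sA /stableP sB /forall_inP H]].
  split; [exact: stableS (subsetUl A B) sAB|exact: stableS (subsetUr A B) sAB|].
  apply/forall_inP => x xA; apply/forall_inP => y yB.
  by move/stableP: sAB; apply; rewrite inE ?xA ?yB ?orbT.
apply/stableP => x y; rewrite !inE => /orP[xA|xB] /orP[yA|yB].
- exact: sA.
- by move/forall_inP: (H x xA); apply.
- by rewrite e_sym; move/forall_inP: (H y yA); apply.
- exact: sB.
Qed.

Lemma stable1 u : stable [set u].
Proof. by apply/stableP => x y /set1P-> /set1P->; rewrite e_irr. Qed.

Lemma stableU1 u (S : {set T}) :
  stable (u |: S) = stable S && [disjoint nbrs u & S].
Proof.
rewrite stableU stable1 disjoint_subset /=; congr andb.
apply/forall_inP/subsetP => [H x|H x /set1P ->].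
  by rewrite !inE => eux; apply: contraL eux => /(forall_inP (H u (set11 u))).
apply/forall_inP => y yS; apply: contraL yS => euy.
by apply: (H y); rewrite inE.
Qed.

Lemma closed_nbrs_disjoint u (S : {set T}) :
  [disjoint closed_nbrs u & S] = (u \notin S) && [disjoint nbrs u & S].
Proof. by rewrite !disjoints_subset subUset sub1set inE. Qed.

Variable lam : R.
Hypothesis lam_gt0 : 0 < lam.

(** The partition function of the hard-core model with fugacity [lam] on the
    subgraph induced on U. *)
Definition partition_fn (U : {set T}) : R :=
  \sum_(S : {set T} | (S \subset U) && stable S) lam ^+ #|S|.

Let Z := partition_fn.

Let weight_ge0 (S : {set T}) : 0 <= lam ^+ #|S|.
Proof. by rewrite exprn_ge0 // ltW. Qed.

Lemma partition_fn_gt0 U : 0 < Z U.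
Proof.
rewrite /Z /partition_fn (bigD1 set0) /=; last by rewrite sub0set stable0.
rewrite cards0 expr0; apply: (lt_le_trans ltr01); rewrite lerDl.
by apply: sumr_ge0 => S _; exact: weight_ge0.
Qed.

Lemma partition_fn_le_expR U : Z U <= expR (lam * #|U|%:R).
Proof.
apply: (@le_trans _ _ (\sum_(S : {set T} | S \subset U) lam ^+ #|S|)).
  rewrite /Z /partition_fn big_mkcondr /=; apply: ler_sum => S _.
  by case: ifP => // _; exact: weight_ge0.
have -> : \sum_(S : {set T} | S \subset U) lam ^+ #|S| = (1 + lam) ^+ #|U|.
  pose F i : R := if i \in U then lam else 0.
  transitivity (\prod_i (F i + 1)).
    rewrite bigA_distr [LHS]big_mkcond /=.
    apply: eq_bigr => S _.
    case: ifPn => [/subsetP sSU|].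
      rewrite -big_mkcond /= -prodr_const; apply: eq_bigr => i iS.
      by rewrite /F sSU.
    move=> /subsetPn[x xS xU]; rewrite (bigD1 x) //= xS /F (negbTE xU).
    by rewrite mul0r.
  rewrite -prodr_const [RHS]big_mkcond /=; apply: eq_bigr => i _.
  by rewrite /F; case: ifP; rewrite ?add0r // addrC.
rewrite mulrC expRM_natl.
apply: lerXn2r; rewrite ?nnegrE ?expR_ge0 ?expR_ge1Dx //.
by rewrite addr_ge0 // ltW.
Qed.

(** Removing u turns the stable sets that contain u into those that avoid the
    closed neighbourhood of u. *)
Lemma sum_stable_mem (U : {set T}) u : u \in U ->
  \sum_(S : {set T} | (S \subset U) && stable S && (u \in S)) lam ^+ #|S| =
  lam * \sum_(S : {set T} | (S \subset U) && stable S &&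
                            [disjoint closed_nbrs u & S]) lam ^+ #|S|.
Proof.
move=> uU.
rewrite (reindex_onto (fun S => u |: S) (fun S => S :\ u)); last first.
  by move=> S /andP[_ uS]; rewrite setD1K.
rewrite big_distrr /=; apply: eq_big => [S|S].
  rewrite setU11 andbT subUset sub1set uU /= stableU1.
  rewrite [in RHS]closed_nbrs_disjoint.
  have -> : ((u |: S) :\ u == S) = (u \notin S).
    apply/eqP/idP => [<-|uS]; first by rewrite !inE eqxx.
    by rewrite setU1K.
  by rewrite !andbA -!andbA; do 2 congr andb; rewrite andbC.
move=> /andP[_ /eqP E].
have uS : u \notin S by rewrite -E !inE eqxx.
by rewrite cardsU1 uS exprS.
Qed.

Lemma sum_stable_mem_le (U : {set T}) u : u \in U ->
  \sum_(S : {set T} | (S \subset U) && stable S && (u \in S)) lam ^+ #|S|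
  <= lam * Z U.
Proof.
move=> uU; rewrite sum_stable_mem // ler_pM2l //.
rewrite big_mkcondr /=; apply: ler_sum => S _.
by case: ifP => // _; exact: weight_ge0.
Qed.

(** After the removal of u, a union bound: a stable set that meets the closed
    neighbourhood of u contains one of its [#|nbrs u :&: U| + 1] points, each
    of which lies in at most a fraction [lam] of the total weight. *)
Lemma sum_stable_mem_ge (U : {set T}) u : u \in U ->
  lam * Z U * (1 - lam * (#|nbrs u :&: U|%:R + 1)) <=
  \sum_(S : {set T} | (S \subset U) && stable S && (u \in S)) lam ^+ #|S|.
Proof.
move=> uU; rewrite sum_stable_mem // -mulrA ler_pM2l //.
have Nsz : #|(closed_nbrs u) :&: U|%:R = #|nbrs u :&: U|%:R + 1 :> R.
  rewrite /closed_nbrs setIUl (setIidPl _) ?sub1set // cardsU1 !inE e_irr /=.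
  by rewrite natrD addrC.
rewrite mulrBr mulr1 lerBlDr.
rewrite [leLHS](bigID (fun S : {set T} => [disjoint closed_nbrs u & S])) /=.
rewrite lerD2l -Nsz.
apply: (@le_trans _ _ (\sum_(w in (closed_nbrs u) :&: U)
  \sum_(S : {set T} | (S \subset U) && stable S && (w \in S)) lam ^+ #|S|)).
  under [leRHS]eq_bigr => w _ do rewrite big_mkcondr /=.
  rewrite exchange_big /= big_mkcondr /=; apply: ler_sum => S /andP[SU _].
  case: ifPn => [|_]; last first.
    by apply: sumr_ge0 => w _; case: ifP => // _; exact: weight_ge0.
  rewrite -setI_eq0 => /set0Pn[w /setIP[wN wS]].
  rewrite (bigD1 w) /=; last by rewrite inE wN (subsetP SU).
  rewrite wS lerDl; apply: sumr_ge0 => w' _.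
  by case: ifP => // _; exact: weight_ge0.
have -> : Z U * (lam * #|(closed_nbrs u) :&: U|%:R) =
    \sum_(w in (closed_nbrs u) :&: U) lam * Z U.
  by rewrite sumr_const -[RHS]mulr_natr; ring.
by apply: ler_sum => w /setIP[_ wU]; exact: sum_stable_mem_le.
Qed.

(** Divided by [Z U], this bounds the expected size of a random stable subset
    of U: summing the previous bound over u, the lower bound is about
    [lam * #|U|] as soon as U spans few edges. *)
Lemma expected_size_ge U :
  Z U * (lam * #|U|%:R * (1 - lam) -
         lam ^+ 2 * (\sum_(u in U) #|nbrs u :&: U|)%:R) <=
  \sum_(S : {set T} | (S \subset U) && stable S) lam ^+ #|S| * #|S|%:R.
Proof.
have -> : \sum_(S : {set T} | (S \subset U) && stable S) lam ^+ #|S| * #|S|%:R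
   = \sum_(u in U)
  \sum_(S : {set T} | (S \subset U) && stable S && (u \in S)) lam ^+ #|S|.
  under [RHS]eq_bigr => w _ do rewrite big_mkcondr /=.
  rewrite exchange_big /=; apply: eq_bigr => S /andP[SU _].
  rewrite -big_mkcondr /= sumr_const mulr_natr; congr (_ *+ _).
  apply: eq_card => x; rewrite [RHS]unfold_in /=.
  by case: (boolP (x \in S)) => [/(subsetP SU)->|]; rewrite ?andbF.
apply: (@le_trans _ _ (\sum_(u in U)
   lam * Z U * (1 - lam * (#|nbrs u :&: U|%:R + 1)))); last first.
  by apply: ler_sum => u; exact: sum_stable_mem_ge.
rewrite -big_distrr /= sumrB sumr_const -big_distrr /= big_split /=.
rewrite sumr_const natr_sum.
by rewrite le_eqVlt; apply/orP; left; apply/eqP; ring.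
Qed.

(** The neighbours of v that can still be added once J is chosen. *)
Definition free_nbrs v (J : {set T}) : {set T} :=
  [set u in nbrs v | [disjoint nbrs u & J]].

(** The spatial Markov property: J is the trace of a stable set outside the
    closed neighbourhood of v, and given J the stable set is completed either
    by v alone or by a stable set of free neighbours. *)
Lemma sum_stable_fiber v (F : {set T} -> R) :
  \sum_(I : {set T} | stable I) F I =
  \sum_(J : {set T} | stable J && [disjoint closed_nbrs v & J])
    (F (v |: J) +
     \sum_(S : {set T} | (S \subset free_nbrs v J) && stable S) F (S :|: J)).
Proof.
rewrite (bigID (fun I : {set T} => v \in I)) /= big_split /=; congr (_ + _).
  rewrite (reindex_onto (fun S => v |: S) (fun S => S :\ v)); last first.
    by move=> S /andP[_ vS]; rewrite setD1K.
  apply: eq_bigl => S; rewrite setU11 andbT stableU1 closed_nbrs_disjoint.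
  have -> : ((v |: S) :\ v == S) = (v \notin S).
    apply/eqP/idP => [<-|vS]; first by rewrite !inE eqxx.
    by rewrite setU1K.
  by rewrite -andbA; congr andb; rewrite andbC.
rewrite (partition_big (fun I => I :\: nbrs v)
  (fun J => stable J && [disjoint closed_nbrs v & J])) /=; last first.
  move=> I /andP[sI vI]; rewrite (stableS (subsetDl _ _) sI) /=.
  rewrite closed_nbrs_disjoint !inE negb_and negbK (negbTE vI) orbT /=.
  by rewrite disjoint_sym disjoints_subset subsetDr.
apply: eq_bigr => J /andP[sJ]; rewrite closed_nbrs_disjoint => /andP[vJ dJ].
rewrite (reindex_onto (fun S => S :|: J) (fun I => I :&: nbrs v)) /=; last first.
  by move=> I /andP[_ /eqP <-]; rewrite setID.
have JN0 : J :&: nbrs v = set0 by apply/eqP; rewrite setIC setI_eq0.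
have JN : J :\: nbrs v = J.
  by apply/setDidPl; rewrite disjoint_sym.
apply: eq_bigl => S.
rewrite setDUl JN setIUl JN0 setU0.
have -> : (S :&: nbrs v == S) = (S \subset nbrs v) by apply/eqP/setIidPl.
case: (boolP (S \subset nbrs v)) => [SN|SN]; last first.
  rewrite andbF; apply/esym/negP => /andP[/subsetP H _].
  by case/negP: SN; apply/subsetP => x /H; rewrite inE => /andP[].
have -> : S :\: nbrs v = set0 by apply/eqP; rewrite setD_eq0.
rewrite set0U eqxx !andbT stableU sJ /=.
have vS : v \notin S.
  by apply/negP => /(subsetP SN); rewrite inE e_irr.
rewrite inE negb_or vS vJ !andbT [RHS]andbC; congr andb.
apply/forall_inP/subsetP => [H x xS|H x xS].
  rewrite inE (subsetP SN) //= disjoint_subset; apply/subsetP => y.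
  rewrite !inE => exy; apply: contraL exy => yJ.
  by move/forall_inP: (H x xS); apply.
apply/forall_inP => y yJ; have := H x xS; rewrite inE => /andP[_].
by rewrite disjoint_sym => /disjointFr /(_ yJ); rewrite inE => ->.
Qed.

(** The powers of E in the hypotheses are tuned to each other: [lam * D] is at
    least [L * (1 + E ^+ 2)], where [E ^+ 2] bounds the partition function of a
    small set of free neighbours, and [lam ^+ 2] times the number of ordered
    edges spanned by a neighbourhood is at most 1. *)
Variables D L E : R.
Hypothesis E_def : E = expR (L + 1).
Hypothesis L_ge0 : 0 <= L.
Hypothesis lamD : lam * D = E ^+ 3.
Hypothesis D_ge : 2 * E ^+ 3 <= D.
Hypothesis sparse : forall v,
  (\sum_(u in nbrs v) #|nbrs u :&: nbrs v|)%:R * E ^+ 6 <= D ^+ 2.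
Hypothesis degree : forall v, #|nbrs v|%:R <= D.

Let E_ge : L + 2 <= E.
Proof. by have := expR_ge1Dx (L + 1); rewrite -E_def; lra. Qed.

Let D_gt0 : 0 < D.
Proof.
apply: lt_le_trans D_ge; rewrite mulr_gt0 // exprn_gt0 //.
by rewrite E_def expR_gt0.
Qed.

(** One completion step of [sum_stable_fiber], with U the set of free
    neighbours.  The threshold [lam * #|U| = 2 * L + 2] separates the two
    sources of the gain: below it [Z U] is at most [E ^+ 2] and the term
    [D * lam] of the completion by v suffices; above it the completion by
    neighbours has expected size at least L. *)
Lemma local_occupancy v (U : {set T}) : U \subset nbrs v ->
  L * (lam + Z U) <= D * lam +
  \sum_(S : {set T} | (S \subset U) && stable S) lam ^+ #|S| * #|S|%:R.
Proof.
move=> UN; have Z0 : 0 < Z U := partition_fn_gt0 U.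
have lam2 : lam <= 1 / 2.
  by rewrite -(ler_pM2r D_gt0) lamD; have := D_ge; lra.
have LD : L <= D.
  by apply: le_trans D_ge; apply: cube_ge; rewrite ?E_ge.
case: (leP (2 * L + 2) (lam * #|U|%:R)) => [big|small]; last first.
  have ZE : Z U <= E ^+ 2.
    apply: le_trans (partition_fn_le_expR U) _.
    by rewrite E_def -expRM_natl ler_expR; lra.
  rewrite [D * lam]mulrC lamD -[leLHS]addr0; apply: lerD; last first.
    by apply: sumr_ge0 => S _; rewrite mulr_ge0 ?weight_ge0.
  have : L * (lam + Z U) <= L * (1 + E ^+ 2).
    by apply: ler_wpM2l => //; lra.
  by move/le_trans; apply; apply: cube_dominates; rewrite ?E_ge.
rewrite mulrDr; apply: lerD; first by rewrite ler_pM2r.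
apply: le_trans (expected_size_ge U); rewrite mulrC ler_pM2l //.
have es : lam ^+ 2 * (\sum_(u in U) #|nbrs u :&: U|)%:R <= 1.
  have : (\sum_(u in U) #|nbrs u :&: U|)%:R <=
         (\sum_(u in nbrs v) #|nbrs u :&: nbrs v|)%:R :> R.
    rewrite ler_nat.
    apply: (@leq_trans (\sum_(u in U) #|nbrs u :&: nbrs v|)).
      by apply: leq_sum => u _; apply/subset_leq_card/setIS.
    rewrite [leqRHS](bigID (fun u => u \in U)) /=.
    apply: leq_trans (leq_addr _ _).
    rewrite leq_eqVlt; apply/orP; left; apply/eqP/eq_bigl => u.
    by case: (boolP (u \in U)) => [/(subsetP UN)->|]; rewrite ?andbF.
  move=> le_e; rewrite -(ler_pM2r (exprn_gt0 2 D_gt0)) mul1r.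
  apply: le_trans (sparse v).
  rewrite -mulrA mulrCA -exprMn lamD -exprM; apply: ler_wpM2r => //.
  by rewrite exprn_ge0 // E_def expR_ge0.
move: es big lam2 lam_gt0 L_ge0.
move: (lam ^+ 2 * _) (lam * #|U|%:R) => y x y1 x1 lam2 l0 L0; nra.
Qed.

(** The weight D on the event that v is chosen balances the two terms: each
    point of I is counted D times as v and at most D times as a neighbour. *)
Lemma vertex_occupancy v :
  L * \sum_(I : {set T} | stable I) lam ^+ #|I| <=
  \sum_(I : {set T} | stable I)
    lam ^+ #|I| * (D * (v \in I)%:R + #|nbrs v :&: I|%:R).
Proof.
rewrite !(sum_stable_fiber v) big_distrr /=.
apply: ler_sum => J /andP[sJ]; rewrite closed_nbrs_disjoint => /andP[vJ dJ].
have JN0 : nbrs v :&: J = set0 by apply/eqP; rewrite setI_eq0.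
have cardSJ (S : {set T}) : S \subset free_nbrs v J -> #|S :|: J| = (#|S| + #|J|)%N.
  move=> /subsetP SU; rewrite cardsU.
  suff -> : S :&: J = set0 by rewrite cards0 subn0.
  apply/eqP; rewrite -subset0 -JN0 setSI //; apply/subsetP => x /SU.
  by rewrite inE => /andP[].
have nbrsSJ (S : {set T}) : S \subset free_nbrs v J -> nbrs v :&: (S :|: J) = S.
  move=> /subsetP SU; rewrite setIUr JN0 setU0; apply/setIidPr.
  by apply/subsetP => x /SU; rewrite inE => /andP[].
have vSJ (S : {set T}) : S \subset free_nbrs v J -> v \in S :|: J = false.
  move=> SU; apply/negP; rewrite inE (negbTE vJ) orbF => vS.
  by move/(subsetP SU): vS; rewrite !inE e_irr.
have -> : \sum_(S : {set T} | (S \subset free_nbrs v J) && stable S)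
     lam ^+ #|S :|: J| = lam ^+ #|J| * Z (free_nbrs v J).
  rewrite big_distrr /=; apply: eq_bigr => S /andP[SU _].
  by rewrite cardSJ // exprD mulrC.
have -> : \sum_(S : {set T} | (S \subset free_nbrs v J) && stable S)
     lam ^+ #|S :|: J| * (D * (v \in S :|: J)%:R + #|nbrs v :&: (S :|: J)|%:R)
   = lam ^+ #|J| * \sum_(S : {set T} | (S \subset free_nbrs v J) && stable S)
        lam ^+ #|S| * #|S|%:R.
  rewrite big_distrr /=; apply: eq_bigr => S /andP[SU _].
  by rewrite cardSJ // nbrsSJ // vSJ //= exprD; ring.
rewrite cardsU1 vJ exprS setU11.
have -> : nbrs v :&: (v |: J) = set0.
  rewrite setIUr JN0 setU0; apply/eqP; rewrite setIC setI_eq0.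
  by rewrite disjoints_subset sub1set !inE e_irr.
rewrite cards0 addr0 mulr1 /=.
have UN : free_nbrs v J \subset nbrs v.
  by apply/subsetP => x; rewrite inE => /andP[].
move: (local_occupancy UN) => /(ler_wpM2l (weight_ge0 J)).
by congr (_ <= _); ring.
Qed.

(** Averaging [vertex_occupancy] over v and bounding the size of a random
    stable set by that of a largest one. *)
Lemma large_stable_set :
  exists2 A, stable A & L * #|T|%:R <= 2 * D * #|A|%:R.
Proof.
have [A sA Amax] :
    {A | stable A & forall B : {set T}, stable B -> (#|B| <= #|A|)%N}.
  have := @eq_bigmax_cond _ [pred A : {set T} | stable A] (fun A => #|A|).
  case; first by apply/card_gt0P; exists set0; rewrite inE stable0.
  move=> A; rewrite inE => sA maxA; exists A => // B sB.
  by rewrite -maxA; apply: (@leq_bigmax_cond _ [pred A | stable A] (fun A => #|A|)).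
exists A => //.
pose W : R := \sum_(I : {set T} | stable I) lam ^+ #|I|.
have W0 : 0 < W.
  rewrite /W (bigD1 set0) ?stable0 //= cards0 expr0.
  apply: (lt_le_trans ltr01); rewrite lerDl.
  by apply: sumr_ge0 => S _; exact: weight_ge0.
rewrite -(ler_pM2r W0).
have -> : L * #|T|%:R * W = \sum_(v : T) L * W.
  by rewrite sumr_const -[RHS]mulr_natr; ring.
apply: le_trans (ler_sum _ (fun v _ => vertex_occupancy v)) _.
rewrite exchange_big /= big_distrr /=; apply: ler_sum => I sI.
rewrite -big_distrr /= mulrC; apply: ler_wpM2r; first exact: weight_ge0.
have -> : 2 * D * #|A|%:R = D * #|A|%:R + D * #|A|%:R by ring.
have IA : D * #|I|%:R <= D * #|A|%:R.
  by rewrite ler_pM2l // ler_nat; exact: Amax.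
rewrite big_split /=; apply: lerD; apply: le_trans IA.
  by rewrite -big_distrr /= -natr_sum -big_mkcond sum1_card.
rewrite -natr_sum.
have -> : (\sum_v #|nbrs v :&: I| = \sum_(u in I) #|nbrs u|)%N.
  under eq_bigr => v _ do rewrite -sum1_card big_mkcond /=.
  rewrite exchange_big /= [RHS]big_mkcond /=; apply: eq_bigr => u _.
  rewrite -big_mkcond /=; case: (boolP (u \in I)) => uI.
    by rewrite -sum1_card; apply: eq_bigl => v; rewrite !inE uI andbT e_sym.
  by apply: big1 => v; rewrite inE (negbTE uI) andbF.
rewrite natr_sum -sum1_card natr_sum mulr_sumr.
by apply: ler_sum => u _; rewrite mulr1; exact: degree.
Qed.

End HardCore.

(** Choosing the fugacity: the condition [lam * D = E ^+ 3] fixes it, and a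
    degree bound of at least [2 * E ^+ 3] keeps it at most 1 / 2. *)
Lemma stable_set_of_sparse_nbrs (R : realType) (T : finType) (e : rel T)
    (D L : R) :
    symmetric e -> irreflexive e -> 0 <= L -> 2 * expR (L + 1) ^+ 3 <= D ->
    (forall v, #|nbrs e v|%:R <= D) ->
    (forall v, (\sum_(u in nbrs e v) #|nbrs e u :&: nbrs e v|)%:R
       * expR (L + 1) ^+ 6 <= D ^+ 2) ->
  exists2 A, stable e A & L * #|T|%:R <= 2 * D * #|A|%:R.
Proof.
move=> e_sym e_irr L0 DE deg sparse.
have E3 : 0 < expR (L + 1) ^+ 3 by rewrite exprn_gt0 // expR_gt0.
have D0 : 0 < D by apply: lt_le_trans DE; rewrite mulr_gt0.
apply: (@large_stable_set _ _ _ e_sym e_irr (expR (L + 1) ^+ 3 / D) _ _ _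
  (expR (L + 1))) => //; first by rewrite divr_gt0.
by rewrite divfK // gt_eqF.
Qed.

(** * Hamming spheres and balls *)

Lemma card_bigcup_le (I T : finType) (P : pred I) (F : I -> {set T}) k :
  (forall i, P i -> #|F i| <= k)%N ->
  (#|\bigcup_(i | P i) F i| <= #|[set i | P i]| * k)%N.
Proof.
move=> Fk; apply: (@leq_trans (\sum_(i | P i) #|F i|)).
  elim/big_rec2: _ => [|i A m _ Am]; first by rewrite cards0.
  by apply: leq_trans (leq_card_setU _ _) _; rewrite leq_add2l.
by rewrite cardsE -sum_nat_const; apply: leq_sum.
Qed.

Lemma subset_of_card (T : finType) (B : {set T}) k :
  (k <= #|B|)%N -> exists2 A : {set T}, A \subset B & #|A| = k.
Proof.
rewrite -bin_gt0 -cards_draws => /card_gt0P[A].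
by rewrite inE => /andP[AB /eqP Ak]; exists A.
Qed.

Section Permutations.
Local Open Scope nat_scope.
Variable n : nat.
Implicit Types (s t : 'S_n) (A B I : {set 'I_n}).

Definition agree s t : {set 'I_n} := [set i | s i == t i].

Lemma card_setC_ord A : #|~: A| = n - #|A|.
Proof. by have := cardsC A; rewrite card_ord => nA; lia. Qed.

Lemma card_draws_ord k : #|[set A : {set 'I_n} | #|A| == k]| = 'C(n, k).
Proof. by rewrite card_draws card_ord. Qed.

Lemma hammingE s t : hamming s t = n - #|agree s t|.
Proof. by rewrite -card_setC_ord; apply: eq_card => i; rewrite !inE. Qed.

Lemma card_agree_le s t : #|agree s t| <= n.
Proof. by have := max_card (agree s t); rewrite card_ord. Qed.

Lemma hamming_le s t d : d <= n -> (hamming s t <= d) = (n - d <= #|agree s t|).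
Proof. by move=> dn; rewrite hammingE; have := card_agree_le s t; lia. Qed.

Lemma hamming_sym s t : hamming s t = hamming t s.
Proof. by apply: eq_card => i; rewrite !inE eq_sym. Qed.

Lemma hamming_mull u s t : hamming (u * s)%g (u * t)%g = hamming s t.
Proof.
rewrite -[RHS](card_preimset _ (@perm_inj _ u)).
by apply: eq_card => i; rewrite !inE !permM.
Qed.

(** Any two such permutations differ by one that fixes A pointwise. *)
Lemma card_perms_prescribed A (f : 'I_n -> 'I_n) :
  #|[set t : 'S_n | [forall i in A, t i == f i]]| <= (n - #|A|)`!.
Proof.
set X := [set t | _].
have [->|[t0 t0X]] := set_0Vmem X; first by rewrite cards0.
rewrite -card_setC_ord -card_perm -(card_imset _ (mulIg t0^-1%g)).
apply/subset_leq_card/subsetP => _ /imsetP[t tX ->].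
apply/subsetP => i; rewrite !inE permM; apply: contraNN => iA.
have agreeA u : u \in X -> u i = f i.
  by rewrite inE => /forall_inP/(_ i iA)/eqP.
by rewrite (agreeA t) // -(agreeA t0) // permK.
Qed.

Definition sphere k : {set 'S_n} := [set s | hamming 1%g s == k].

Definition pointed_sphere k : {set 'S_n * 'I_n} :=
  [set p | (p.1 \in sphere k) && (p.1 p.2 != p.2)].

Lemma in_sphere s k : (s \in sphere k) = (#|[set i | s i != i]| == k).
Proof.
rewrite inE; congr (_ == k); apply: eq_card => i.
by rewrite !inE perm1 eq_sym.
Qed.

Lemma card_pointed_sphere k : #|pointed_sphere k| = k * #|sphere k|.
Proof.
rewrite -sum1_card.
rewrite (eq_bigl (fun p => (p.1 \in sphere k) && (p.1 p.2 != p.2))); last first.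
  by move=> p; rewrite inE.
rewrite -(pair_big_dep (mem (sphere k)) (fun s i => s i != i) (fun _ _ => 1)) /=.
rewrite mulnC -sum_nat_const; apply: eq_bigr => s; rewrite in_sphere => /eqP <-.
by rewrite -sum1_card; apply: eq_bigl => i; rewrite inE.
Qed.

(** Composing with [tperm i j] inserts the fixed point j into the cycle of the
    moved point i. *)
Lemma insert_point s (i j : 'I_n) : s i != i -> s j = j ->
  [set x | (tperm i j * s)%g x != x] = j |: [set x | s x != x].
Proof.
move=> si sj; apply/setP => x; rewrite !inE permM.
have ij : i != j by apply: contraNneq si => ->; rewrite sj.
case: tpermP => [->|->|/eqP xi /eqP xj].
- by rewrite sj eq_sym ij si orbT.
- by rewrite eqxx; apply: contraNneq ij => sij;
  rewrite -(inj_eq (@perm_inj _ s)) sij sj.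
- by rewrite (negbTE xj).
Qed.

(** Inserting a fixed point into a cycle is invertible once the inserted point
    is known: it can be cut out again, and the place of insertion is its
    preimage. *)
Lemma card_sphere_step k :
  k * (n - k) * #|sphere k| <= k.+1 * #|sphere k.+1|.
Proof.
rewrite -card_pointed_sphere.
pose X := [set q : 'S_n * 'I_n * 'I_n |
  (q.1 \in pointed_sphere k) && (q.1.1 q.2 == q.2)].
have -> : k * (n - k) * #|sphere k| = #|X|.
  rewrite -[RHS]sum1_card (eq_bigl (fun q : 'S_n * 'I_n * 'I_n =>
    (q.1 \in pointed_sphere k) && (q.1.1 q.2 == q.2))); last first.
    by move=> q; rewrite inE.
  rewrite -(pair_big_dep (mem (pointed_sphere k))
     (fun p i => p.1 i == i) (fun _ _ => 1)) /=.
  rewrite mulnAC -card_pointed_sphere -sum_nat_const; apply: eq_bigr => p.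
  rewrite inE in_sphere => /andP[/eqP pk _].
  rewrite -pk -card_setC_ord.
  by rewrite -sum1_card; apply: eq_bigl => i; rewrite !inE negbK.
pose f (q : 'S_n * 'I_n * 'I_n) := ((tperm q.1.2 q.2 * q.1.1)%g, q.2).
rewrite -(@card_in_imset _ _ f); last first.
  move=> [[s i] j] [[s' i'] j']; rewrite !inE /=.
  move=> /andP[_ /eqP sj] /andP[_ /eqP sj'].
  case=> E jj'; rewrite -{}jj' in sj' E *.
  have ii' : i = i'.
    have := congr1 (fun t : 'S_n => (t^-1)%g j) E.
    rewrite !invMg !tpermV !permM.
    have -> : (s^-1)%g j = j by rewrite -{1}sj permK.
    have -> : (s'^-1)%g j = j by rewrite -{1}sj' permK.
    by rewrite !tpermR.
  by rewrite -{}ii' in E *; move/mulgI: E => ->.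
apply/subset_leq_card/subsetP => _ /imsetP[[[s i] j] + ->].
rewrite !inE /= => /andP[/andP[sk si] /eqP sj].
have ij : i != j by apply: contraNneq si => ->; rewrite sj.
have sphE (u : 'S_n) m : (hamming 1%g u == m) = (#|[set x | u x != x]| == m).
  by have := in_sphere u m; rewrite inE.
move: sk; rewrite !sphE insert_point // cardsU1 inE sj eqxx /= => /eqP->.
rewrite eqxx permM tpermR /=; apply: contraNneq ij => sij.
by rewrite -(inj_eq (@perm_inj _ s)) sij sj.
Qed.

Lemma card_sphere2 : n * n.-1 <= 2 * #|sphere 2|.
Proof.
rewrite -card_pointed_sphere.
pose X := [set q : 'I_n * 'I_n | q.1 != q.2].
have -> : n * n.-1 = #|X|.
  rewrite -[RHS]sum1_card.
  rewrite (eq_bigl (fun q : 'I_n * 'I_n => true && (q.1 != q.2))); last first.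
    by move=> q; rewrite inE.
  rewrite -(pair_big_dep xpredT (fun i j : 'I_n => i != j) (fun _ _ => 1)) /=.
  rewrite -{1}(card_ord n) -sum_nat_const; apply: eq_bigr => i _.
  have := cardsC1 i; rewrite card_ord -sum1_card => <-.
  by apply: eq_bigl => j; rewrite !inE eq_sym.
pose f (q : 'I_n * 'I_n) := (tperm q.1 q.2, q.1).
rewrite -(@card_in_imset _ _ f); last first.
  move=> [i j] [i' j'] _ _ [E ii']; rewrite -{}ii' in E *; congr (_, _).
  by rewrite -(tpermL i j) E tpermL.
apply/subset_leq_card/subsetP => _ /imsetP[[i j] + ->].
rewrite !inE /= => ij; rewrite tpermL [j == i]eq_sym ij andbT.
have : tperm i j \in sphere 2.
  rewrite in_sphere; apply/eqP; rewrite -[RHS](_ : #|[set i; j]| = 2).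
    apply: eq_card => x; rewrite !inE; case: tpermP => [->|->|/eqP xi /eqP xj].
    - by rewrite eqxx eq_sym ij.
    - by rewrite eqxx ij orbT.
    - by rewrite eqxx (negbTE xi) (negbTE xj).
  by rewrite cards2 ij.
by rewrite inE.
Qed.

(** Iterating [card_sphere_step] from the transpositions.  The true order is
    [n ^_ d] itself, by the count of derangements; the factor d lost here is
    harmless against exponential gains. *)
Lemma card_sphere_ge d : 1 < d <= n -> n ^_ d <= d * #|sphere d|.
Proof.
case: d => [|[|d]] //; rewrite ltnS => /andP[_].
elim: d => [_|d IH dn].
  by apply: leq_trans card_sphere2; rewrite !ffactnS ffactn0 muln1.
rewrite ffactnSr; apply: leq_trans (card_sphere_step _).
by rewrite mulnAC leq_mul2r IH ?orbT // ltnW.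
Qed.

Lemma vol_per_sphere d : vol_per n d.+1 = vol_per n d + #|sphere d.+1|.
Proof.
rewrite /vol_per -cardsUI [X in _ = _ + X](_ : _ = 0) ?addn0.
  by apply: eq_card => s; rewrite !inE -ltnS leq_eqVlt orbC ltnS.
apply/eqP; rewrite cards_eq0; apply/eqP/setP => s; rewrite !inE.
by case: eqP => [->|]; rewrite ?andbF // ltnn.
Qed.

Lemma vol_per_gt0 d : 0 < vol_per n d.
Proof.
apply/card_gt0P; exists 1%g; rewrite inE /hamming.
by rewrite (eq_card (B := pred0)) ?card0 // => i; rewrite !inE eqxx.
Qed.

Lemma vol_per0 : vol_per n 0 = 1.
Proof.
apply/eqP/cards1P; exists 1%g; apply/setP => s; rewrite !inE leqn0 cards_eq0.
apply/eqP/eqP => [H|->]; last by apply/setP => i; rewrite !inE eqxx.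
apply/permP => i; apply/esym/eqP.
by move/setP/(_ i): H; rewrite !inE => /negbFE.
Qed.

(** The identity is set aside because it has no moved point after which a fixed
    point could be inserted; for k > 0, [card_sphere_step] gives a factor
    [(n - k) / 2] from the sphere of radius k to the next one. *)
Lemma vol_per_growth d : d <= n ->
  (n - d) * (vol_per n d - 1) <= 2 * vol_per n d.+1.
Proof.
elim: d => [_|d IH dn]; first by rewrite vol_per0 subnn muln0.
have step : (n - d.+1) * #|sphere d.+1| <= 2 * #|sphere d.+2|.
  have := card_sphere_step d.+1.
  move: #|_| #|_| => a b H; rewrite -(leq_pmul2l (ltn0Sn d)); nia.
have [v0 /(_ (ltnW dn)) IHd] := (vol_per_gt0 d, IH).
rewrite (vol_per_sphere d.+1) mulnDr.
apply: leq_trans (leq_add IHd step).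
rewrite [in X in X <= _]vol_per_sphere -addnBAC // mulnDr leq_add2r.
by rewrite leq_mul2r; apply/orP; right; lia.
Qed.

Lemma vol_per_ratio d : 1 < d <= n ->
  (n - d) * vol_per n d <= 4 * vol_per n d.+1.
Proof.
move=> /andP[d1 dn]; have := vol_per_growth dn.
have : 1 < vol_per n d.
  apply: (@leq_trans (vol_per n 2)).
    have := card_sphere2; rewrite vol_per_sphere.
    have : 2 * 1 <= n * n.-1 by apply: leq_mul; lia.
    have := vol_per_gt0 1; lia.
  by apply/subset_leq_card/subsetP => s; rewrite !inE => /leq_trans; apply.
nia.
Qed.

Lemma vol_per_ge d : 1 < d <= n -> 'C(n, d) * d`! <= d * vol_per n d.
Proof.
move=> dn; rewrite bin_ffact; apply: leq_trans (card_sphere_ge dn) _.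
rewrite leq_mul2l; apply/orP; right; apply/subset_leq_card/subsetP => s.
by rewrite !inE => /eqP->.
Qed.

(** * Local sparsity of the Hamming graph *)

Definition close_pairs d : {set 'S_n * 'S_n} :=
  [set p | [&& hamming 1%g p.1 <= d, hamming 1%g p.2 <= d &
              hamming p.1 p.2 <= d]].

(** The points fixed by t and the points where t agrees with s overlap in common
    fixed points of s and t only.  When these are few, at least n - d + r values
    of t are prescribed; [4 ^ n] counts the possible pairs of point sets. *)
Lemma card_few_common_fixpoints d r s : r <= n - d -> d <= n ->
  #|[set t | [&& hamming 1%g t <= d, hamming s t <= d &
      #|agree 1%g s :&: agree 1%g t| < n - d - r]]| <= 4 ^ n * (d - r)`!.
Proof.
move=> rm dn; set X := [set t | _].
pose P (p : {set 'I_n} * {set 'I_n}) := n - d + r <= #|p.1 :|: p.2|.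
pose F (p : {set 'I_n} * {set 'I_n}) : {set 'S_n} :=
  [set t : 'S_n | [forall i in p.1 :|: p.2,
                    t i == if i \in p.1 then i else s i]].
have sXF : X \subset \bigcup_(p | P p) F p.
  apply/subsetP => t; rewrite inE !hamming_le // => /and3P[t1 ts few].
  apply/bigcupP; exists (agree 1%g t, agree s t).
    have : #|agree 1%g t :&: agree s t| <= #|agree 1%g s :&: agree 1%g t|.
      apply/subset_leq_card/subsetP => i; rewrite !inE.
      by move=> /andP[/eqP-> /eqP->]; rewrite eqxx.
    have arith m u i a b c : r <= m -> u + i = a + b -> m <= a -> m <= b ->
      c < m - r -> i <= c -> m + r <= u by lia.
    exact: arith rm (cardsUI _ _) t1 ts few.
  rewrite inE; apply/forall_inP => i; rewrite /= !inE perm1.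
  by case: (i =P t i) => [<-|_] /= => [_|/eqP->]; rewrite eqxx.
apply: leq_trans (subset_leq_card sXF) _.
apply: leq_trans (@card_bigcup_le _ _ _ _ (d - r)`! _) _ => [p Pp|].
  apply: leq_trans (card_perms_prescribed _ _) _.
  by apply: leq_fact; move: Pp; rewrite /P; lia.
rewrite leq_mul2r; apply/orP; right.
apply: leq_trans (max_card _) _.
by rewrite card_prod -cardsT -powersetT card_powerset cardsT card_ord -expnMn.
Qed.

(** A permutation counted here has at least n - d fixed points, hence at least
    r of them outside I: once r of these are chosen, at most [d`!]
    permutations remain. *)
Lemma card_fixing I d r : r <= n - d -> d <= n -> #|I| = n - d - r ->
  #|[set s : 'S_n | (I \subset agree 1%g s) && (hamming 1%g s <= d)]|
    <= 'C(n, r) * d`!.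
Proof.
move=> rm dn cI; set X := [set s | _].
pose F A : {set 'S_n} := [set t : 'S_n | [forall i in I :|: A, t i == i]].
have sXF : X \subset
    \bigcup_(A : {set 'I_n} | (#|A| == r) && (#|I :|: A| == n - d)) F A.
  apply/subsetP => s; rewrite inE hamming_le // => /andP[Is s1].
  have [|A /subsetP AsI cA] := @subset_of_card _ (agree 1%g s :\: I) r.
    by have := cardsID I (agree 1%g s); rewrite (setIidPr Is); lia.
  apply/bigcupP; exists A.
    rewrite cA eqxx /= cardsU cI cA (_ : I :&: A = set0).
      by rewrite cards0 subn0 subnK.
    apply/setP => i; rewrite !inE; apply/negP => /andP[iI /AsI].
    by rewrite inE iI.
  rewrite inE; apply/forall_inP => i; rewrite inE => iIA.
  have : i \in agree 1%g s.
    by case/orP: iIA => [/(subsetP Is)|/AsI /setDP[]].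
  by rewrite inE perm1 eq_sym.
apply: leq_trans (subset_leq_card sXF) _.
apply: leq_trans (@card_bigcup_le _ _ _ _ d`! _) _ => [A /andP[_ /eqP cA]|].
  apply: leq_trans (card_perms_prescribed _ _) _.
  by rewrite cA subKn.
rewrite leq_mul2r; apply/orP; right; rewrite -card_draws_ord.
by apply/subset_leq_card/subsetP => A; rewrite !inE => /andP[].
Qed.

(** A union bound over the sets I of n - d - r common fixed points. *)
Lemma card_many_common_fixpoints d r : r <= n - d -> d <= n ->
  #|[set p : 'S_n * 'S_n | [&& hamming 1%g p.1 <= d, hamming 1%g p.2 <= d &
      n - d - r <= #|agree 1%g p.1 :&: agree 1%g p.2|]]|
    <= 'C(n, n - d - r) * ('C(n, r) * d`!) ^ 2.
Proof.
move=> rm dn; set X := [set p | _].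
pose G I : {set 'S_n} :=
  [set s : 'S_n | (I \subset agree 1%g s) && (hamming 1%g s <= d)].
have sXF : X \subset \bigcup_(I : {set 'I_n} | #|I| == n - d - r) setX (G I) (G I).
  apply/subsetP => p; rewrite inE => /and3P[p1 p2 /subset_of_card[I]].
  rewrite subsetI => /andP[I1 I2] cI; apply/bigcupP; exists I; first exact/eqP.
  by rewrite !inE I1 I2 p1 p2.
apply: leq_trans (subset_leq_card sXF) _.
rewrite -card_draws_ord.
apply: card_bigcup_le => I /eqP cI.
by rewrite cardsX -mulnn; apply: leq_mul; apply: card_fixing.
Qed.

Lemma card_close_pairs d r : r <= n - d -> d <= n ->
  #|close_pairs d| <= vol_per n d * (4 ^ n * (d - r)`!) +
                      'C(n, n - d - r) * ('C(n, r) * d`!) ^ 2.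
Proof.
move=> rm dn.
pose few (p : 'S_n * 'S_n) := #|agree 1%g p.1 :&: agree 1%g p.2| < n - d - r.
rewrite -(cardsID [set p | few p]); apply: leq_add; last first.
  apply: leq_trans (card_many_common_fixpoints rm dn).
  apply/subset_leq_card/subsetP => p; rewrite !inE /few -leqNgt.
  by case/andP=> -> /and3P[-> -> _].
rewrite -sum1_card.
rewrite (eq_bigl (fun p => (p.1 \in hamming_ball 1%g d) &&
   [&& hamming 1%g p.2 <= d, hamming p.1 p.2 <= d & few p])); last first.
  by move=> p; rewrite !inE -!andbA.
rewrite -(pair_big_dep (mem (hamming_ball 1%g d)) (fun s t =>
   [&& hamming 1%g t <= d, hamming s t <= d & few (s, t)]) (fun _ _ => 1)) /=.
rewrite /vol_per -sum_nat_const; apply: leq_sum => s _.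
apply: leq_trans (card_few_common_fixpoints s rm dn).
by rewrite sum1dep_card.
Qed.

End Permutations.

Lemma bin_sub_le n m r : (r <= m)%N -> (m <= n)%N ->
  ('C(n, m - r) <= 'C(n, m) * 'C(n, r))%N.
Proof.
move=> rm mn.
have trinomial : ('C(n, m) * 'C(m, r) = 'C(n, m - r) * 'C(n - (m - r), r))%N.
  have rn : (r <= n - (m - r))%N by lia.
  have := bin_fact rn; rewrite (_ : n - (m - r) - r = n - m)%N; last by lia.
  have := bin_fact (leq_trans (leq_subr r m) mn).
  have := bin_fact mn; have := bin_fact rm.
  have f0 : (0 < r`! * (m - r)`! * (n - m)`!)%N by rewrite !muln_gt0 !fact_gt0.
  move=> E1 E2 E3 E4; apply/eqP; rewrite -(eqn_pmul2r f0); apply/eqP.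
  transitivity n`!; first by rewrite -E2 -E1; ring.
  by rewrite -E3 -E4; ring.
apply: (@leq_trans ('C(n, m) * 'C(m, r))); last first.
  by rewrite leq_mul2l leq_bin2l ?orbT.
by rewrite trinomial leq_pmulr // bin_gt0; lia.
Qed.

Lemma exp2_le_bin n d : (2 * d <= n)%N -> (2 ^ d <= 'C(n, d))%N.
Proof.
elim: d n => [|d IH] n dn; first by rewrite bin0.
rewrite -(leq_pmul2l (ltn0Sn d)) -mul_bin_diag expnS mulnCA mulnA.
have dn' : (2 * d <= n.-1)%N by lia.
by apply: leq_mul (IH _ dn'); lia.
Qed.

(** * Asymptotic estimates *)

Section Estimates.
Variable R : realType.
Implicit Types (a x delta : R).

Lemma expr_le_fact_expR x r : 0 <= x -> x ^+ r <= r`!%:R * expR x.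
Proof.
move=> x0; case: r => [|r].
  by rewrite expr0 fact0 mul1r; have := expR_ge1Dx x; lra.
have := expR_ge1Dxn r x0.
have f0 : 0 < (r.+1)`!%:R :> R by rewrite ltr0n fact_gt0.
move=> H; rewrite -ler_pdivrMl // mulrC; lra.
Qed.

Lemma natr_le_expR x n : 0 < x -> n%:R <= x^-1 * expR (x * n%:R).
Proof.
move=> x0; rewrite -ler_pdivrMl ?invr_gt0 // invrK.
by have := expR_ge1Dx (x * n%:R); lra.
Qed.

(** A single term of the binomial expansion of (1 + a)^n, with 1 / a bounded by
    exp (1 / a). *)
Lemma bin_le_expR a n r : 0 < a -> r%:R <= a ^+ 2 * n%:R ->
  'C(n, r)%:R <= expR (2 * a * n%:R).
Proof.
move=> a0 rn.
have Cr : 'C(n, r)%:R * a ^+ r <= (1 + a) ^+ n.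
  have [rn'|nr] := leqP r n; last first.
    by rewrite bin_small // mul0r exprn_ge0 // addr_ge0 // ltW.
  rewrite exprDn (bigD1 (Ordinal (rn' : r < n.+1)%N)) //= expr1n mul1r.
  rewrite mulr_natl lerDl; apply: sumr_ge0 => i _.
  by rewrite expr1n mul1r mulrn_wge0 // exprn_ge0 // ltW.
have ar0 : 0 < a ^+ r by rewrite exprn_gt0.
have -> : 2 * a * n%:R = n%:R * a + a * n%:R by ring.
rewrite -(ler_pM2r ar0); apply: le_trans Cr _.
have e1 : (1 + a) ^+ n <= expR (n%:R * a).
  rewrite expRM_natl; apply: lerXn2r; rewrite ?nnegrE ?expR_ge0 ?expR_ge1Dx //.
  by rewrite addr_ge0 // ltW.
have e2 : 1 <= expR (a * n%:R) * a ^+ r.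
  rewrite -ler_pdivrMr // mul1r -exprVn.
  apply: (@le_trans _ _ (expR (r%:R * a^-1))).
    rewrite expRM_natl; apply: lerXn2r;
      rewrite ?nnegrE ?expR_ge0 ?invr_ge0 ?(ltW a0) //.
    by have := expR_ge1Dx a^-1; lra.
  by rewrite ler_expR ler_pdivrMr // mulrAC -expr2.
rewrite expRD -mulrA -[leLHS]mulr1; apply: ler_pM => //.
by rewrite exprn_ge0 // addr_ge0 // ltW.
Qed.

Lemma expR_half_le2 : expR (1 / 2) <= 2 :> R.
Proof.
have := expR_ge1Dx (- (1 / 2) : R); rewrite expRN => H.
have e0 := expR_gt0 (1 / 2 : R).
have : (1 / 2) * expR (1 / 2) <= (expR (1 / 2))^-1 * expR (1 / 2) :> R.
  by rewrite ler_pM2r //; lra.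
by rewrite mulVf ?gt_eqF //; lra.
Qed.

Lemma expR_half_le_exp2 m : expR (m%:R / 2) <= (2 ^ m)%:R :> R.
Proof.
rewrite -[m%:R / 2](_ : m%:R * (1 / 2) = _); last by rewrite mul1r.
rewrite expRM_natl natrX; apply: lerXn2r; rewrite ?nnegrE ?expR_ge0 //.
exact: expR_half_le2.
Qed.

(** By symmetry of the binomial one may take 2 k <= n, where 'C(n, k) is at
    least 2^k. *)
Lemma bin_ge_expR delta n d : delta * n%:R <= d%:R ->
  d%:R <= (1 - delta) * n%:R -> (d <= n)%N ->
  expR (delta * n%:R / 2) <= 'C(n, d)%:R.
Proof.
move=> lo hi dn.
suff main k : (2 * k <= n)%N -> delta * n%:R <= k%:R ->
    expR (delta * n%:R / 2) <= 'C(n, k)%:R.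
  have [d2|d2] := leqP (2 * d) n; first exact: main.
  rewrite -bin_sub //; apply: main; first lia.
  rewrite natrB //; lra.
move=> k2 kd; apply: (@le_trans _ _ (2 ^ k)%:R);
  last by rewrite ler_nat exp2_le_bin.
by apply: le_trans (expR_half_le_exp2 k); rewrite ler_expR; lra.
Qed.

(** [card_close_pairs] relative to the square of the volume; the factors
    [n%:R] and [n%:R ^+ 2] come from the loss in [vol_per_ge]. *)
Lemma close_pairs_le_vol n d r : (1 < d)%N -> (d <= n)%N -> (r <= n - d)%N ->
  (r <= d)%N ->
  #|close_pairs n d|%:R <= (vol_per n d)%:R ^+ 2 *
    (n%:R * 4 ^+ n / r`!%:R + n%:R ^+ 2 * 'C(n, r)%:R ^+ 3 / 'C(n, d)%:R) :> R.
Proof.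
move=> d1 dn rm rd.
set v := vol_per n d.
have vge : ('C(n, d) * d`! <= n * v)%N.
  apply: leq_trans (vol_per_ge _) _; first by rewrite d1.
  by rewrite leq_mul2r dn orbT.
have C0 : (0 < 'C(n, d))%N by rewrite bin_gt0.
have few : (v * (4 ^ n * (d - r)`!) * r`! <= v ^ 2 * (n * 4 ^ n))%N.
  have H : ((d - r)`! * r`! <= n * v)%N.
    apply: leq_trans vge; rewrite -(bin_fact rd) mulnA.
    rewrite [X in (X <= _)%N]mulnC leq_pmull // muln_gt0 C0 bin_gt0.
    by [].
  apply: leq_trans (leq_trans _ (leq_mul (leqnn (v * 4 ^ n)) H)) _;
    by rewrite leq_eqVlt; apply/orP; left; apply/eqP; ring.
have many : ('C(n, n - d - r) * ('C(n, r) * d`!) ^ 2 * 'C(n, d)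
    <= v ^ 2 * (n ^ 2 * 'C(n, r) ^ 3))%N.
  have H1 : ('C(n, n - d - r) <= 'C(n, d) * 'C(n, r))%N.
    by rewrite -(bin_sub dn) bin_sub_le // leq_subr.
  have H2 := leq_mul vge vge.
  have H3 := leq_mul H1 (leqnn (('C(n, r) * d`!) ^ 2 * 'C(n, d))).
  rewrite mulnA in H3; apply: leq_trans H3 _.
  have H4 := leq_mul H2 (leqnn ('C(n, r) ^ 3)).
  apply: leq_trans (leq_trans _ H4) _; rewrite leq_eqVlt; apply/orP; left.
    by apply/eqP; ring.
  by apply/eqP; ring.
apply: (@le_trans _ _ (v * (4 ^ n * (d - r)`!) +
                      'C(n, n - d - r) * ('C(n, r) * d`!) ^ 2)%N%:R).
  by rewrite ler_nat card_close_pairs.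
rewrite natrD mulrDr; apply: lerD.
  rewrite mulrA ler_pdivlMr ?ltr0n ?fact_gt0 //.
  by rewrite -!natrX -!natrM ler_nat.
rewrite mulrA ler_pdivlMr ?ltr0n //.
by rewrite -!natrX -!natrM ler_nat.
Qed.

(** Since x^r / r! is at most exp x, the factorial of r beats every
    exponential; the base x = exp (4 / a^2) makes x^r exceed exp (4 n) up to a
    constant for r close to a^2 n. *)
Lemma fact_ge_expR a n r : 0 < a -> a ^+ 2 * n%:R - 1 <= r%:R ->
  expR (4 * n%:R) <=
    r`!%:R * expR (expR (4 / a ^+ 2) + 4 / a ^+ 2).
Proof.
move=> a0 rn; set b := 4 / a ^+ 2.
have := expr_le_fact_expR r (expR_ge0 b).
rewrite -expRM_natl => H; rewrite expRD mulrA.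
rewrite -ler_pdivrMr ?expR_gt0 // -expRN -expRD; apply: le_trans H.
rewrite ler_expR.
have -> : 4 * n%:R - b = (a ^+ 2 * n%:R - 1) * b.
  by rewrite /b; field; rewrite gt_eqF.
by rewrite ler_pM2r // divr_gt0 // exprn_gt0.
Qed.

(** With r about a^2 n, the first term of [close_pairs_le_vol] is
    superexponentially small, while in the second the cube of 'C(n, r) is at
    most exp (6 a n); the value of a makes this a quarter of the exponent
    delta n / 2 available from 'C(n, d). *)
Lemma close_pairs_sparse delta : 0 < delta -> delta < 1 ->
  exists2 K, 0 < K & forall n d, (1 < d)%N -> delta * n%:R <= d%:R ->
    d%:R <= (1 - delta) * n%:R ->
    #|close_pairs n d|%:R <=
      (vol_per n d)%:R ^+ 2 * (K * expR (- (delta * n%:R / 4))).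
Proof.
move=> delta0 delta1.
pose a := delta / 48.
pose B := expR (4 / a ^+ 2) + 4 / a ^+ 2.
have a0 : 0 < a by rewrite /a; lra.
(* K2 pays for the factor n ^+ 2, absorbed as exp (delta * n / 8) *)
pose K1 := expR B; pose K2 := ((delta / 16) ^-1) ^+ 2.
exists (K1 + K2).
  by rewrite addr_gt0 ?expR_gt0 // exprn_gt0 // invr_gt0; lra.
move=> n d d1 lo hi.
have n0 : 0 <= n%:R :> R by [].
have dn : (d <= n)%N by rewrite -(ler_nat R); nra.
pose r := Num.trunc (a ^+ 2 * n%:R).
have an0 : 0 <= a ^+ 2 * n%:R by rewrite mulr_ge0 // exprn_ge0 // ltW.
have /andP[rle rgt] := truncn_itv an0.
rewrite -/r in rle rgt.
have ad : a ^+ 2 * n%:R <= delta * n%:R.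
  by apply: ler_wpM2r => //; rewrite /a; nra.
have rd : (r <= d)%N by rewrite -(ler_nat R); lra.
have rm : (r <= n - d)%N by rewrite -(ler_nat R) natrB //; lra.
apply: le_trans (close_pairs_le_vol d1 dn rm rd) _.
apply: ler_wpM2l; first exact: exprn_ge0.
rewrite mulrDl; apply: lerD.
  have f0 : 0 < r`!%:R :> R by rewrite ltr0n fact_gt0.
  rewrite ler_pdivrMr //.
  have rn : a ^+ 2 * n%:R - 1 <= r%:R.
    by move: rgt; rewrite -natr1; lra.
  have := fact_ge_expR a0 rn; rewrite -/B -/K1 => H.
  apply: (@le_trans _ _ (expR (4 * n%:R) * expR (- (delta * n%:R / 4))));
    last first.
    apply: (@le_trans _ _ (r`!%:R * K1 * expR (- (delta * n%:R / 4)))).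
      by rewrite ler_pM2r ?expR_gt0.
    by rewrite le_eqVlt; apply/orP; left; apply/eqP; ring.
  apply: (@le_trans _ _ (expR n%:R * expR (2 * n%:R))).
    apply: ler_pM; rewrite ?exprn_ge0 //.
      by have := expR_ge1Dx (n%:R : R); lra.
    rewrite mulrC expRM_natl; apply: lerXn2r; rewrite ?nnegrE ?expR_ge0 //.
    have : expR 2 = expR 1 ^+ 2 :> R by rewrite -expRM_natl mulr1.
    by have := expR_ge1Dx (1 : R); nra.
  by rewrite -!expRD ler_expR; nra.
have C0 : 0 < 'C(n, d)%:R :> R by rewrite ltr0n bin_gt0.
have Cd := bin_ge_expR lo hi dn.
have Cr := bin_le_expR a0 rle.
rewrite ler_pdivrMr //.
apply: (@le_trans _ _
  (K2 * expR (- (delta * n%:R / 4)) * expR (delta * n%:R / 2))); last first.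
  by rewrite ler_pM2l // mulr_gt0 ?expR_gt0 // exprn_gt0 // invr_gt0; lra.
have d16 : 0 < delta / 16 by lra.
apply: (@le_trans _ _ (((delta / 16)^-1 * expR (delta / 16 * n%:R)) ^+ 2 *
  expR (2 * a * n%:R) ^+ 3)).
  apply: ler_pM; rewrite ?exprn_ge0 //.
    by apply: lerXn2r;
      rewrite ?nnegrE ?mulr_ge0 ?expR_ge0 ?invr_ge0 ?natr_le_expR ?(ltW d16).
  by apply: lerXn2r; rewrite ?nnegrE ?expR_ge0.
rewrite exprMn -/K2 -[leLHS]mulrA -[leRHS]mulrA; apply: ler_wpM2l.
  by rewrite exprn_ge0 // invr_ge0 ltW.
by rewrite -!expRM_natl -!expRD ler_expR /a; lra.
Qed.

End Estimates.

(** * Permutation codes as stable sets *)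

Section HammingGraph.
Variables n d : nat.

Definition hamming_close (s t : 'S_n) : bool := (s != t) && (hamming s t <= d)%N.

Lemma hamming_close_sym : symmetric hamming_close.
Proof. by move=> s t; rewrite /hamming_close eq_sym hamming_sym. Qed.

Lemma hamming_close_irr : irreflexive hamming_close.
Proof. by move=> s; rewrite /hamming_close eqxx. Qed.

Lemma stable_min_dist_ge (C : {set 'S_n}) :
  stable hamming_close C = min_dist_ge d.+1 C.
Proof.
apply: eq_forallb => s; congr implb; apply: eq_forallb => t; congr implb.
by rewrite /hamming_close negb_and negbK -ltnNge; case: eqP.
Qed.

Lemma card_nbrs_le (s : 'S_n) : (#|nbrs hamming_close s| <= vol_per n d)%N.
Proof.
rewrite -(card_hamming_ball s); apply/subset_leq_card/subsetP => t.
by rewrite !inE => /andP[].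
Qed.

(** Left translation by the inverse of s carries the neighbourhood of s into the
    ball around the identity. *)
Lemma nbrs_edges_le (s : 'S_n) :
  (\sum_(u in nbrs hamming_close s)
     #|nbrs hamming_close u :&: nbrs hamming_close s| <= #|close_pairs n d|)%N.
Proof.
under eq_bigr => u _ do rewrite -sum1_card.
rewrite pair_big_dep /= sum1dep_card.
pose f (p : 'S_n * 'S_n) := ((s^-1 * p.1)%g, (s^-1 * p.2)%g).
rewrite -(@card_imset _ _ f); last first.
  by move=> [u t] [u' t'] [/mulgI-> /mulgI->].
apply/subset_leq_card/subsetP => _ /imsetP[[u t] + ->].
have close u' : hamming 1%g (s^-1 * u')%g = hamming s u'.
  by rewrite -(mulVg s) hamming_mull.
rewrite !inE /= hamming_mull !close /hamming_close.
by case/and3P=> /andP[_ ->] /andP[_ ->] /andP[_ ->].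
Qed.

End HammingGraph.

Section Codes.
Variable R : realType.

Lemma A_per_ge_sparse n d (L : R) :
    0 <= L -> 2 * expR (L + 1) ^+ 3 <= (vol_per n d)%:R ->
    #|close_pairs n d|%:R * expR (L + 1) ^+ 6 <= (vol_per n d)%:R ^+ 2 ->
  L * n`!%:R <= 2 * (vol_per n d)%:R * (A_per n d.+1)%:R.
Proof.
move=> L0 vol_big sparse.
have [s|s|C] := @stable_set_of_sparse_nbrs R _ _ (vol_per n d)%:R L
    (@hamming_close_sym n d) (@hamming_close_irr n d) L0 vol_big.
- by rewrite ler_nat card_nbrs_le.
- apply: le_trans sparse; apply: ler_wpM2r; first by rewrite exprn_ge0 ?expR_ge0.
  by rewrite ler_nat nbrs_edges_le.
rewrite stable_min_dist_ge => mC; rewrite card_Sn => /le_trans; apply.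
rewrite ler_wpM2l ?mulr_ge0 // ler_nat.
exact: (@leq_bigmax_cond _ (min_dist_ge d.+1) (fun C => #|C|)).
Qed.

Lemma A_per_gt0 n m : (0 < A_per n m)%N.
Proof.
have := @leq_bigmax_cond _ (@min_dist_ge n m) (fun C => #|C|) [set 1%g].
rewrite cards1; apply; apply/forall_inP => s /set1P->.
by apply/forall_inP => t /set1P->; rewrite eqxx.
Qed.

Lemma exp2_A_per_le_num_codes n m : (2 ^ A_per n m <= num_codes n m)%N.
Proof.
have [|C mC AE] := @eq_bigmax_cond _ (@min_dist_ge n m) (fun C => #|C|).
  apply/card_gt0P; exists set0; rewrite unfold_in.
  by apply/forall_inP => s; rewrite inE.
rewrite [A_per n m]AE -card_powerset; apply/subset_leq_card/subsetP => B.
rewrite !inE => /subsetP BC; apply/forall_inP => s sB; apply/forall_inP => t tB.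
by have /forall_inP/(_ _ (BC _ sB))/forall_inP/(_ _ (BC _ tB)) := mC.
Qed.

(** The choice L = a n with a = delta / 48 leaves room: the sparsity gained is
    exp (- delta n / 4) = exp (- 12 a n), while exp (- 6 a n) is required, and
    the surplus absorbs the constant K for large n. *)
Lemma A_per_ge_improved (delta : R) : 0 < delta -> delta < 1 ->
  exists (c : R) (N : nat), 0 < c /\ forall n d, (N <= n)%N -> (1 < d)%N ->
    delta * n%:R <= d%:R -> d%:R <= (1 - delta) * n%:R ->
    c * n%:R * n`!%:R <= (A_per n d.+1)%:R * (vol_per n d)%:R.
Proof.
move=> delta0 delta1; have [K K0 sparse] := close_pairs_sparse delta0 delta1.
pose a := delta / 48.
have a0 : 0 < a by rewrite /a; lra.
pose N := (Num.trunc (K * expR 6 / (6 * a) + a^-1)).+1.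
exists (a / 2), N; split; first lra.
move=> n d Nn d1 lo hi.
have n0 : 0 <= n%:R :> R by [].
have dn : (d <= n)%N by rewrite -(ler_nat R); nra.
have [nK na] : K * expR 6 <= 6 * a * n%:R /\ 1 <= a * n%:R.
  have : K * expR 6 / (6 * a) + a^-1 < n%:R.
    by apply: lt_le_trans (truncnS_gt _) _; rewrite ler_nat.
  have ia : 0 < a^-1 by rewrite invr_gt0.
  have : 0 < K * expR 6 / (6 * a) by rewrite !mulr_gt0 ?expR_gt0 ?invr_gt0; lra.
  move=> X0 XY; split.
    by rewrite [leRHS]mulrC -ler_pdivrMr ?mulr_gt0 //; lra.
  by rewrite [leRHS]mulrC -ler_pdivrMr // mul1r; lra.
have v0 : 0 < (vol_per n d)%:R :> R by rewrite ltr0n vol_per_gt0.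
suff : a * n%:R * n`!%:R <= 2 * (vol_per n d)%:R * (A_per n d.+1)%:R by lra.
apply: A_per_ge_sparse; first by rewrite mulr_ge0 // ltW.
  have vC : 'C(n, d)%:R <= (vol_per n d)%:R :> R.
    have dn2 : (1 < d <= n)%N by rewrite d1.
    have := vol_per_ge dn2; rewrite ler_nat.
    case: d d1 {lo hi dn v0 dn2} => // d d1; rewrite factS mulnCA leq_pmul2l //.
    by apply: leq_trans; rewrite leq_pmulr // fact_gt0.
  apply: le_trans vC; apply: le_trans (bin_ge_expR lo hi dn).
  rewrite -expRM_natl.
  apply: (@le_trans _ _ (expR 1 * expR (3 * (a * n%:R + 1)))).
    by rewrite ler_pM2r ?expR_gt0 //; have := expR_ge1Dx (1 : R); lra.
  rewrite -expRD ler_expR.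
  have -> : delta * n%:R / 2 = 24 * (a * n%:R) by rewrite /a; field.
  lra.
apply: le_trans (ler_wpM2r _ (sparse n d d1 lo hi)) _.
  by rewrite exprn_ge0 ?expR_ge0.
rewrite -[leLHS]mulrA -[leRHS]mulr1; apply: ler_wpM2l; first by rewrite exprn_ge0.
rewrite -expRM_natl -[leLHS]mulrA -expRD.
have -> : - (delta * n%:R / 4) + 6 * (a * n%:R + 1) = 6 - 6 * a * n%:R.
  by rewrite /a; field.
rewrite expRD mulrA expRN ler_pdivrMr ?expR_gt0 // mul1r.
apply: le_trans nK _; have := expR_ge1Dx (6 * a * n%:R); lra.
Qed.

End Codes.

Theorem theorem2p7 (R : realType) (eps : R) (heps0 : 0 < eps)
    (heps1 : eps < 1 / 2) :
  exists c : R, 0 < c /\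
    forall n d : nat, (0 < n)%N -> (0 < d)%N ->
      eps * n%:R < d%:R -> d%:R < (1 - eps) * n%:R ->
      c * n%:R * (n`!%:R / (vol_per n d)%:R) <= (A_per n d.+1)%:R /\
      expR (c * n%:R ^+ 2 * (n`!%:R / (vol_per n d)%:R))
        <= (num_codes n d)%:R.
Proof.
have delta0 : 0 < eps / 2 by lra.
have delta1 : eps / 2 < 1 by lra.
have [c0 [N0 [c00 main]]] := A_per_ge_improved delta0 delta1.
pose N := maxn N0 (Num.trunc (4 / eps)).+1.
pose M : R := N%:R ^+ 2 * N`!%:R.
have N1 : 1 <= N%:R :> R by rewrite ler1n leq_max orbT.
have F1 : 1 <= N`!%:R :> R by rewrite ler1n fact_gt0.
have M1 : 1 <= M by rewrite -[leLHS]mulr1 ler_pM // expr_ge1.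
(* for n < N the bound 1 / (2 * M) makes the two lower bounds at most 1 and
   exp (1 / 2), so that any nonempty code suffices; eps / 8 combines the
   volume ratio eps * n / 4 with the passage from powers of 2 to expR *)
pose c := Num.min (Num.min c0 (c0 * eps / 8)) (1 / (2 * M)).
have cc0 : c <= c0 by rewrite /c !ge_min lexx.
have cc1 : c <= c0 * eps / 8 by rewrite /c !ge_min lexx orbT.
have cM : c * M <= 1 / 2.
  have : c <= 1 / (2 * M) by rewrite /c ge_min lexx orbT.
  by rewrite ler_pdivlMr; lra.
have c_gt0 : 0 < c.
  rewrite /c !lt_min c00 /=; apply/andP; split; first by rewrite !mulr_gt0; lra.
  by rewrite divr_gt0; lra.
exists c; split=> // n d n0 d0 lo hi.
have v0 : 0 < (vol_per n d)%:R :> R by rewrite ltr0n vol_per_gt0.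
have v1 : 1 <= (vol_per n d)%:R :> R by rewrite ler1n vol_per_gt0.
have nn : 1 <= n%:R :> R by rewrite ler1n.
have q0 : 0 <= n`!%:R / (vol_per n d)%:R :> R by rewrite divr_ge0.
have codes := exp2_A_per_le_num_codes n d.
have codesR : expR ((A_per n d)%:R / 2) <= (num_codes n d)%:R :> R.
  by apply: le_trans (expR_half_le_exp2 R _) _; rewrite ler_nat.
have [nN|Nn] := ltnP n N.
  have small : c * n%:R ^+ 2 * (n`!%:R / (vol_per n d)%:R) <= 1 / 2.
    apply: le_trans cM; rewrite -mulrA ler_pM2l //; apply: ler_pM => //.
    - by rewrite exprn_ge0.
    - by apply: lerXn2r; rewrite ?nnegrE // ler_nat ltnW.
    - rewrite ler_pdivrMr //; apply: (@le_trans _ _ (N`!%:R * 1)).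
        by rewrite mulr1 ler_nat leq_fact // ltnW.
      by rewrite ler_wpM2l.
  split.
    apply: (@le_trans _ _ 1); last by rewrite ler1n A_per_gt0.
    apply: le_trans (le_trans small _); last lra.
    by apply: ler_wpM2r => //; rewrite ler_pM2l // expr2 ler_peMl; lra.
  apply: le_trans codesR; rewrite ler_expR; apply: le_trans small _.
  have : 1 <= (A_per n d)%:R :> R by rewrite ler1n A_per_gt0.
  lra.
have N0n : (N0 <= n)%N by apply: leq_trans Nn; rewrite leq_maxl.
have en : 4 < eps * n%:R.
  rewrite mulrC -ltr_pdivrMr //; apply: lt_le_trans (truncnS_gt _) _.
  by rewrite ler_nat; apply: leq_trans Nn; rewrite leq_maxr.
split.
  have d1 : (1 < d)%N by rewrite -(ltr_nat R); lra.
  have := main n d N0n d1; rewrite mulrA ler_pdivrMr // => H.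
  apply: le_trans (H _ _); [|nra|nra].
  by apply: ler_wpM2r => //; apply: ler_wpM2r => //.
(* codes of minimum distance d: the first part for the radius d - 1 *)
have [d' dd'] : {d' | d = d'.+1} by exists d.-1; rewrite prednK.
rewrite {}dd' in lo hi d0 v0 v1 q0 codes codesR *.
rewrite -natr1 in lo hi.
have d1 : (1 < d')%N by rewrite -(ltr_nat R); lra.
have dn : (d' <= n)%N by rewrite -(ler_nat R); nra.
apply: le_trans codesR; rewrite ler_expR mulrA ler_pdivrMr //.
have w0 : 0 < (vol_per n d')%:R :> R by rewrite ltr0n vol_per_gt0.
have := main n d' N0n d1; move=> /(_ _ _)H.
have {}H : c0 * n%:R * n`!%:R <= (A_per n d'.+1)%:R * (vol_per n d')%:R.
  by apply: H; nra.
have ratio : (eps * n%:R) * (vol_per n d')%:R <= 4 * (vol_per n d'.+1)%:R.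
  have dn2 : (1 < d' <= n)%N by rewrite d1.
  have := vol_per_ratio dn2; rewrite -(ler_nat R) !natrM natrB //.
  apply: le_trans; rewrite ler_pM2r //; lra.
rewrite -(ler_pM2r w0).
apply: (@le_trans _ _
  ((c0 * n%:R * n`!%:R) * (eps * n%:R * (vol_per n d')%:R) / 8)).
  have -> : c0 * n%:R * n`!%:R * (eps * n%:R * (vol_per n d')%:R) / 8 =
     c0 * eps / 8 * (n%:R ^+ 2 * n`!%:R * (vol_per n d')%:R) by field.
  rewrite -[c * _ * _]mulrA -[c * _ * _]mulrA.
  by apply: ler_wpM2r; rewrite ?mulr_ge0 ?exprn_ge0.
have : c0 * n%:R * n`!%:R * (eps * n%:R * (vol_per n d')%:R) <=
   ((A_per n d'.+1)%:R * (vol_per n d')%:R) * (4 * (vol_per n d'.+1)%:R).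
  by apply: ler_pM => //; rewrite !mulr_ge0 // ltW.
lra.
Qed.
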